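(* Let $\rho$ be a $C^3$ function on a domain $\Omega\subset\mathbb{S}^2$, let $p\in\Omega$ be a point at which $R_\rho$ is an immersion, and let $(x,y)$ be the coordinates around $p$ provided by stereographic projection from the antipodal point of $p$, with $p$ corresponding to $(0,0)$ and the round metric equal to $\frac{16|dz|^2}{(4+|z|^2)^2}$, $z=x+iy$. At $p$ put $$E=\rho_{xx}+\tfrac12(\rho_y^2-\rho_x^2-1),\quad F=\rho_{xy}-\rho_x\rho_y,\quad G=\rho_{yy}+\tfrac12(\rho_x^2-\rho_y^2-1),$$ $$\mathcal{D}=(EG-F^2)e^{-2\rho}+\frac{e^{2\rho}}{4}+\frac{E+G}{2}.$$ Then the second fundamental form of $\Sigma(\rho)$ at $p$ (in the frame induced by $\partial_x,\partial_y$) is $$\Pi^i_j=\mathcal{D}^{-1}\left[\begin{pmatrix} \frac{E-G}{2} & F \\ F & \frac{G-E}{2} \end{pmatrix}+\Big[(EG-F^2)e^{-2\rho}-\frac{e^{2\rho}}{4}\Big]\mathrm{Id}\right].$$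
   Context: Hyperbolic 3-space $\mathbb{H}^3$ is the open unit ball in $\mathbb{R}^3$ with metric $\langle\cdot,\cdot\rangle=4|dx|^2/(1-|x|^2)^2$ and Levi-Civita connection $\nabla$; its ideal boundary is the unit sphere $\mathbb{S}^2$. For $\rho$ on $\Omega\subset\mathbb{S}^2$, $\Sigma(\rho)$ is the surface parametrized by $R_\rho:\Omega\to\mathbb{H}^3$, $$R_\rho(\theta)=\frac{|D\rho|^2+(e^{2\rho}-1)}{|D\rho|^2+(e^{\rho}+1)^2}\,\theta+\frac{2D\rho}{|D\rho|^2+(e^\rho+1)^2},$$ where $D\rho$ is the gradient of $\rho$ in the round metric, regarded as a vector in $\mathbb{R}^3$ tangent to $\mathbb{S}^2$ at $\theta$. It is the outer envelope of the horospheres $H(\theta,\rho(\theta))$ based at $\theta$ with signed distance $\rho(\theta)$ from the origin; its unit normal $N$ at $R_\rho(\theta)$ is the unit normal of $H(\theta,\rho(\theta))$ pointing into the horoball (the geodesic with initial velocity $N$ converges to $\theta$). With $X_1=\partial_xR_\rho$, $X_2=\partial_yR_\rho$: $g_{ij}=\langle X_i,X_j\rangle$, $\Pi_{ij}=\langle\nabla_{X_j}X_i,N\rangle$, $\Pi^i_j=g^{ik}\Pi_{kj}$. *)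

(* Defs.v *)
From mathcomp Require Import all_boot all_order all_algebra.
From mathcomp Require Import all_classical all_reals all_analysis.
Import Order.TTheory GRing.Theory Num.Theory.
Import numFieldNormedType.Exports.

Set Implicit Arguments.
Unset Strict Implicit.
Unset Printing Implicit Defensive.

Local Open Scope classical_set_scope.
Local Open Scope ring_scope.

(* Euclidean inner product; the norm `|x| of MathComp-Analysis on row vectors
   is the sup norm and is not used below. *)
Definition dot {R : realType} {n : nat} (u v : 'rV[R]_n) : R :=
  \sum_(i < n) u 0 i * v 0 i.

Definition mx2 {R : realType} (a b c d : R) : 'M[R]_2 :=
  \matrix_(i, j) if i == 0 then (if j == 0 then a else b)
                 else (if j == 0 then c else d).

Definition partial {R : realType} {m : nat} {V : normedModType R} (i : 'I_m.+1)
    (f : 'rV[R]_m.+1 -> V) (z : 'rV[R]_m.+1) : V :=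
  'D_(delta_mx 0 i) f z.

Fixpoint Ck {R : realType} {m : nat} (k : nat) (U : set 'rV[R]_m.+1)
    (f : 'rV[R]_m.+1 -> R) : Prop :=
  (forall z, U z -> {for z, continuous f}) /\
  match k with
  | 0%N => True
  | k'.+1 => forall i : 'I_m.+1,
      (forall z, U z -> derivable f z (delta_mx 0 i)) /\ Ck k' U (partial i f)
  end.

(** The round sphere *)

Definition sphere2 {R : realType} : set 'rV[R]_3 := [set x | dot x x = 1].

Definition sphere_domain {R : realType} (Omega : set 'rV[R]_3) : Prop :=
  [/\ exists2 U : set 'rV[R]_3, open U & Omega = U `&` sphere2, Omega !=set0
    & connected Omega].

(* The rows of e form an orthonormal basis of the tangent plane at p. *)
Definition tangent_frame {R : realType} (p : 'rV[R]_3) (e : 'M[R]_(2, 3)) :=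
  e *m e^T = 1%:M /\ p *m e^T = 0.

(* Inverse of the stereographic projection from -p onto the plane tangent to
   the sphere at p: the point of the sphere on the line through -p and
   p + x e_1 + y e_2, where z = (x, y). In these coordinates the round metric
   is 16 |dz|^2 / (4 + |z|^2)^2, and p corresponds to z = 0. *)
Definition stereo {R : realType} (p : 'rV[R]_3) (e : 'M[R]_(2, 3))
    (z : 'rV[R]_2) : 'rV[R]_3 :=
  - p + (4 / (4 + dot z z)) *: (2 *: p + z *m e).

(* Functions on a subset of the sphere are total functions on R^3 whose values
   off that subset are irrelevant. *)
Definition Ck_on_sphere {R : realType} (k : nat) (Omega : set 'rV[R]_3)
    (rho : 'rV[R]_3 -> R) : Prop :=
  forall p e, sphere2 p -> tangent_frame p e ->
    Ck k (stereo p e @^-1` Omega) (rho \o stereo p e).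

(* v is tangent at theta and represents the differential of rho there, i.e.
   (rho o c)'(0) = <v, c'(0)> for all curves c in the sphere with
   c(0) = theta. *)
Definition is_sphere_gradient {R : realType} (rho : 'rV[R]_3 -> R)
    (theta v : 'rV[R]_3) : Prop :=
  dot theta v = 0 /\
  forall (c : R -> 'rV[R]_3) (w : 'rV[R]_3),
    (forall t, sphere2 (c t)) -> c 0 = theta -> is_derive (0 : R) (1 : R) c w ->
    is_derive (0 : R) (1 : R) (rho \o c) (dot v w).

(** The ball model of hyperbolic 3-space *)

Definition hyp {R : realType} (x u v : 'rV[R]_3) : R :=
  4 * dot u v / (1 - dot x x) ^+ 2.

Definition hyp_mx {R : realType} (x : 'rV[R]_3) : 'M[R]_3 :=
  \matrix_(i, j) hyp x (delta_mx 0 i) (delta_mx 0 j).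

(* christoffel x k i j is the Christoffel symbol Gamma^k_ij of the Levi-Civita
   connection of hyp, in the Cartesian coordinates of the ball. *)
Definition christoffel {R : realType} (x : 'rV[R]_3) (k i j : 'I_3) : R :=
  2^-1 * \sum_(l < 3) invmx (hyp_mx x) k l *
    (partial i (fun y => hyp_mx y j l) x
     + partial j (fun y => hyp_mx y i l) x
     - partial l (fun y => hyp_mx y i j) x).

(* The horosphere H(theta, s) is the Euclidean sphere internally tangent to
   the ideal boundary at theta whose point closest to the origin is
   tanh(s/2) theta, at signed hyperbolic distance s from the origin;
   the segment from tanh(s/2) theta to theta is a diameter of it. *)
Definition horosphere_center {R : realType} (theta : 'rV[R]_3) (s : R) :
    'rV[R]_3 :=
  ((1 + (expR s - 1) / (expR s + 1)) / 2) *: theta.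

(* N is the unit normal at x of the horosphere H(theta, s) that points into
   the horoball; the tangent plane at x of the horosphere is the set of v
   Euclidean-orthogonal to the radius. *)
Definition is_horosphere_normal {R : realType} (theta : 'rV[R]_3) (s : R)
    (x N : 'rV[R]_3) : Prop :=
  let r := horosphere_center theta s - x in
  [/\ hyp x N N = 1, forall v, dot v r = 0 -> hyp x v N = 0 & 0 < dot N r].

(* R_rho, where Drho is the gradient field of rho. *)
Definition envelope {R : realType} (rho : 'rV[R]_3 -> R)
    (Drho : 'rV[R]_3 -> 'rV[R]_3) (theta : 'rV[R]_3) : 'rV[R]_3 :=
  let D := Drho theta in
  let s := rho theta in
  ((dot D D + (expR (2 * s) - 1)) / (dot D D + (expR s + 1) ^+ 2)) *: theta
  + (2 / (dot D D + (expR s + 1) ^+ 2)) *: D.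

(** Parametrized surfaces X in hyperbolic 3-space, with X_i = partial i X *)

Definition immersion_at {R : realType} (X : 'rV[R]_2 -> 'rV[R]_3)
    (z : 'rV[R]_2) : Prop :=
  row_free (\matrix_(i < 2) partial i X z).

(* nabla_{X_j} X_i, for the Levi-Civita connection of hyp. *)
Definition cov_deriv {R : realType} (X : 'rV[R]_2 -> 'rV[R]_3) (z : 'rV[R]_2)
    (j i : 'I_2) : 'rV[R]_3 :=
  partial j (partial i X) z +
  \row_k \sum_(a < 3) \sum_(b < 3)
    christoffel (X z) k a b * partial j X z 0 a * partial i X z 0 b.

Definition first_form {R : realType} (X : 'rV[R]_2 -> 'rV[R]_3)
    (z : 'rV[R]_2) : 'M[R]_2 :=
  \matrix_(i, j) hyp (X z) (partial i X z) (partial j X z).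

Definition second_form {R : realType} (X : 'rV[R]_2 -> 'rV[R]_3)
    (z : 'rV[R]_2) (N : 'rV[R]_3) : 'M[R]_2 :=
  \matrix_(i, j) hyp (X z) (cov_deriv X z j i) N.

(* The matrix (Pi^i_j), i.e. Pi^i_j = g^{ik} Pi_{kj}. *)
Definition shape_mx {R : realType} (X : 'rV[R]_2 -> 'rV[R]_3)
    (z : 'rV[R]_2) (N : 'rV[R]_3) : 'M[R]_2 :=
  invmx (first_form X z) *m second_form X z N.

(* Main.v *)
Require Import Defs.
From mathcomp Require Import all_boot all_order all_algebra.
From mathcomp Require Import all_classical all_reals all_analysis.
From mathcomp Require Import ring lra.
Import Order.TTheory GRing.Theory Num.Theory.
Import numFieldNormedType.Exports.
Local Open Scope classical_set_scope.
Local Open Scope ring_scope.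

Set Implicit Arguments.
Unset Strict Implicit.
Unset Printing Implicit Defensive.

(** Write theta for the stereographic chart, f for rho in this chart, a for the
exponential of f, and Drho for the gradient. The envelope has a simple form in
terms of W = Drho - (a + 1) theta:

  X = theta + (2 / |W|^2) W,   |W|^2 = |Drho|^2 + (a + 1)^2,

that is, X - theta is the image of W / 2 under the inversion u |-> u / |u|^2.
The differential of this inversion is, up to a factor, the reflection S in W,
so that X_i = (2 / |W|^2) S V_i for an explicit V_i (envelope_partial). The
relations <W, theta> = - (a + 1) and <W, theta_i> = f_i show that V_i is
orthogonal to theta, while the Euclidean radius n = c - X of the horosphere
with centre c = (a / (a + 1)) theta is a multiple of S theta. Hence n is normal
to the surface on the whole chart (radius_normal), and differentiating
<X_i, n> = 0 expresses <X_ij, n> through first derivatives of X and c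
(dot_second_partial). The third derivatives of f thus never need to be
computed: it is enough that they exist.

The hyperbolic metric is conformal to the Euclidean one, so its Christoffel
symbols are explicit (christoffelE), and N is a positive multiple of n
(horosphere_normalE). At p this gives

  V_i = sum_k B_ik e_k,  B = [[E, F], [F, G]] + (a^2 / 2) Id,
  g = t B B^T,           Pi = g - t a^2 B

with the same factor t <> 0 in g and in Pi (dot_envelope_partial,
second_form_envelope). The matrix B is symmetric because mixed partial
derivatives commute (schwarz), and it is invertible because the envelope is an
immersion (tangent_coef_mx_unit). Therefore g^-1 Pi = Id - a^2 B^-1
(shape_mx_envelope), and as det B = a^2 D, writing B^-1 by cofactors gives the
formula (shape_algebra). *)

(** * The Euclidean inner product *)

Lemma sum2 (V : nmodType) (F : 'I_2 -> V) : \sum_i F i = F 0 + F 1.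
Proof.
rewrite !big_ord_recl big_ord0 addr0; congr (F _ + F _); exact/val_inj.
Qed.

Lemma sum_delta {R : pzRingType} n (k : 'I_n) (F : 'I_n -> R) :
  \sum_i (k == i)%:R * F i = F k.
Proof.
rewrite (bigD1 k)//= eqxx mul1r big1 ?addr0// => i ik.
by rewrite eq_sym (negbTE ik) mul0r.
Qed.

Section Dot.
Context {R : realType} {n : nat}.
Implicit Types u v w : 'rV[R]_n.

Lemma dotC u v : dot u v = dot v u.
Proof. by apply: eq_bigr => i _; rewrite mulrC. Qed.

Lemma dotDl u v w : dot (u + v) w = dot u w + dot v w.
Proof. by rewrite -big_split; apply: eq_bigr => i _; rewrite mxE mulrDl. Qed.

Lemma dotZl (a : R) u v : dot (a *: u) v = a * dot u v.
Proof. by rewrite mulr_sumr; apply: eq_bigr => i _; rewrite mxE mulrA. Qed.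

Lemma dotDr u v w : dot w (u + v) = dot w u + dot w v.
Proof. by rewrite dotC dotDl !(dotC w). Qed.

Lemma dotZr (a : R) u v : dot u (a *: v) = a * dot u v.
Proof. by rewrite dotC dotZl dotC. Qed.

Lemma dotNl u v : dot (- u) v = - dot u v.
Proof. by rewrite -scaleN1r dotZl mulN1r. Qed.

Lemma dotNr u v : dot u (- v) = - dot u v.
Proof. by rewrite dotC dotNl dotC. Qed.

Definition dotE := (dotDl, dotDr, dotZl, dotZr, dotNl, dotNr).

Lemma dot0 v : dot 0 v = 0.
Proof. by rewrite /dot big1// => k _; rewrite mxE mul0r. Qed.

Lemma dot_delta v i : dot v (delta_mx 0 i) = v 0 i.
Proof.
rewrite -[RHS](sum_delta i (v 0)); apply: eq_bigr => k _.
by rewrite mxE eqxx/= eq_sym mulrC.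
Qed.

Lemma dot_ge0 u : 0 <= dot u u.
Proof. by apply: sumr_ge0 => i _; rewrite -expr2 sqr_ge0. Qed.

Lemma dot_eq0 u : dot u u = 0 -> u = 0.
Proof.
move=> /eqP; rewrite psumr_eq0 => [/allP u0|i _]; last by rewrite -expr2 sqr_ge0.
apply/rowP => i; rewrite mxE; apply/eqP.
by have := u0 i (mem_index_enum i); rewrite mulf_eq0 orbb.
Qed.

Lemma mulmx_dot u v : u *m v^T = (dot u v)%:M.
Proof.
apply/matrixP => i j; rewrite !ord1 !mxE eqxx mulr1n.
by apply: eq_bigr => k _; rewrite mxE.
Qed.

End Dot.

(** * Directional derivatives *)

Section DirectionalDerivative.
Context {R : realType} {V : normedModType R}.

Lemma is_derive_mxP m n (M : V -> 'M[R]_(m, n)) (dM : 'M[R]_(m, n)) (z v : V) :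
  is_derive z v M dM <->
  forall i j, is_derive z v (fun y => M y i j) (dM i j).
Proof.
split=> [[Md <-] i j|Md].
  have /derivable_mxP/(_ i j) := Md.
  by move=> /derivableP; rewrite derive_mx// mxE.
have Mder : derivable M z v by apply/derivable_mxP => i j; case: (Md i j).
apply: DeriveDef => //; rewrite derive_mx//; apply/matrixP => i j.
by rewrite mxE; case: (Md i j).
Qed.

(** Directional derivatives are derivatives along lines; this transports
one-variable results such as the chain rule and the mean value theorem. *)
Lemma is_derive_line (W : normedModType R) (g : V -> W) (dg : W) (z v : V) :
  is_derive z v g dg <-> is_derive (0 : R) (1 : R) (fun t => g (t *: v + z)) dg.
Proof.
have E : 'D_v g z = 'D_(1 : R) (fun t : R => g (t *: v + z)) 0.
  rewrite /derive; set g1 := fun h => h^-1 *: _; set g2 := fun h => h^-1 *: _.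
  suff -> : g1 = g2 by [].
  by apply/funext => h; rewrite /g1 /g2 /= addr0 scale0r add0r [_%:A]mulr1.
split=> -[gd <-]; apply: DeriveDef; rewrite ?E//.
  exact: (derivable1P _ _ _).1.
exact: (derivable1P _ _ _).2.
Qed.

Lemma is_derive_mul (f g : V -> R) (df dg : R) (z v : V) :
  is_derive z v f df -> is_derive z v g dg ->
  is_derive z v (fun y => f y * g y) (df * g z + f z * dg).
Proof.
move=> fd gd; apply: (is_derive_eq (is_deriveM fd gd)).
by rewrite /GRing.scale/= addrC (mulrC (g z)).
Qed.

Lemma is_derive_scale m n (a : V -> R) (u : V -> 'M[R]_(m, n)) da du (z v : V) :
  is_derive z v a da -> is_derive z v u du ->
  is_derive z v (fun y => a y *: u y) (da *: u z + a z *: du).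
Proof.
move=> ad /is_derive_mxP ud; apply/is_derive_mxP => i j.
rewrite !mxE; under eq_fun do rewrite mxE.
exact: is_derive_mul.
Qed.

Lemma is_derive_dot n (u w : V -> 'rV[R]_n) du dw (z v : V) :
  is_derive z v u du -> is_derive z v w dw ->
  is_derive z v (fun y => dot (u y) (w y)) (dot du (w z) + dot (u z) dw).
Proof.
move=> /is_derive_mxP ud /is_derive_mxP wd; rewrite /dot -big_split/=.
rewrite (_ : (fun y => _) = \sum_(i < n) (fun y => u y 0 i * w y 0 i)).
  by apply: is_derive_sum => i; exact: is_derive_mul.
by apply/funext => y; rewrite fct_sumE.
Qed.

Lemma is_derive_inv (a : V -> R) da (z v : V) :
  a z != 0 -> is_derive z v a da ->
  is_derive z v (fun y => (a y)^-1) (- da / a z ^+ 2).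
Proof.
move=> az [ad <-]; apply: DeriveDef; first exact: derivableV.
by rewrite deriveV// /GRing.scale/= mulrC mulrN mulNr.
Qed.

Lemma is_derive_expR_comp (a : V -> R) da (z v : V) :
  is_derive z v a da ->
  is_derive z v (fun y => expR (a y)) (expR (a z) * da).
Proof.
move=> /is_derive_line ad; apply/is_derive_line.
have := @is_derive1_comp R expR (fun t => a (t *: v + z)) 0 _ _ _ ad.
rewrite scale0r add0r; apply; exact: is_derive_expR.
Qed.

End DirectionalDerivative.

Lemma is_derive_open_eq {R : realType} {V W : normedModType R} (U : set V)
    (f g : V -> W) (z v : V) df :
  open U -> U z -> (forall y, U y -> f y = g y) ->
  is_derive z v f df -> is_derive z v g df.
Proof.
move=> oU Uz fg; apply: near_eq_is_derive.
by near=> y; apply: fg; near: y; exact: open_nbhs_nbhs.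
Unshelve. all: by end_near. Qed.

Lemma is_derive_coord {R : realType} n (z v : 'rV[R]_n) i :
  is_derive z v (fun y : 'rV[R]_n => y 0 i) (v 0 i).
Proof. by have /is_derive_mxP := is_derive_id z v. Qed.

Lemma is_derive_open_unique {R : realType} {V W : normedModType R} (U : set V)
    (f g : V -> W) (z v : V) df dg :
  open U -> U z -> (forall y, U y -> f y = g y) ->
  is_derive z v f df -> is_derive z v g dg -> df = dg.
Proof.
move=> oU Uz fg fd [_ <-].
by have [_ ->] := is_derive_open_eq oU Uz fg fd.
Qed.

Lemma is_derive_partial {R : realType} {m : nat} {V : normedModType R} (i : 'I_m.+1)
    (g : 'rV[R]_m.+1 -> V) z dg :
  is_derive z (delta_mx 0 i) g dg -> partial i g z = dg.
Proof. by case. Qed.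

(** * Iterated partial derivatives *)

Section Dk.
Context {R : realType} {m : nat}.
Implicit Type U : set 'rV[R]_m.+1.

(** Bare existence of the iterated partial derivatives of order at most k, for
vector-valued maps. Continuity is left out so that the closure properties
below reduce to the Leibniz and chain rules. *)
Fixpoint Dk {V : normedModType R} (k : nat) U (g : 'rV[R]_m.+1 -> V) : Prop :=
  match k with
  | 0%N => True
  | k'.+1 => forall i : 'I_m.+1,
      (forall z, U z -> derivable g z (delta_mx 0 i)) /\ Dk k' U (partial i g)
  end.

Lemma Ck_Dk k U (f : 'rV[R]_m.+1 -> R) : Ck k U f -> Dk k U f.
Proof.
by elim: k f => //= k IH f [_ H] i; have [Hd /IH] := H i; split.
Qed.

Lemma Ck_pred k U (f : 'rV[R]_m.+1 -> R) :
  Ck k.+1 U f -> Ck k U f.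
Proof.
elim: k f => [|k IH] f [fc fd]; split => // i.
by have [fi /IH] := fd i; split.
Qed.

Lemma Dk_is_derive k U (V : normedModType R) (g : 'rV[R]_m.+1 -> V) i z :
  Dk k.+1 U g -> U z -> is_derive z (delta_mx 0 i) g (partial i g z).
Proof. by move=> /(_ i)[gd _] Uz; exact/derivableP/gd. Qed.

Lemma Dk_partial k U (V : normedModType R) (g : 'rV[R]_m.+1 -> V) i :
  Dk k.+1 U g -> Dk k U (partial i g).
Proof. by move=> /(_ i)[]. Qed.

Lemma Dk_ext k U (V : normedModType R) (f g : 'rV[R]_m.+1 -> V) : open U ->
  (forall z, U z -> f z = g z) -> Dk k U f -> Dk k U g.
Proof.
move=> oU; elim: k f g => //= k IH f g fg fD i.
have gd z : U z -> is_derive z (delta_mx 0 i) g (partial i f z).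
  move=> Uz; apply: is_derive_open_eq fg _ => //.
  exact: Dk_is_derive fD _.
split=> [z /gd[]//|]; apply: IH (Dk_partial i fD) => z /gd[_].
by rewrite /partial => ->.
Qed.

(** All closure properties are proved by exhibiting the partial derivatives up
to equality on U. *)
Lemma Dk_rec k U (V : normedModType R) (g : 'rV[R]_m.+1 -> V)
    (dg : 'I_m.+1 -> 'rV[R]_m.+1 -> V) : open U ->
  (forall i z, U z -> is_derive z (delta_mx 0 i) g (dg i z)) ->
  (forall i, Dk k U (dg i)) -> Dk k.+1 U g.
Proof.
move=> oU gd dgD i; split; first by move=> z /(gd i)[].
by apply: (Dk_ext oU _ (dgD i)) => z /(gd i)[_]; rewrite /partial => ->.
Qed.

Lemma Dk_pred k U (V : normedModType R) (g : 'rV[R]_m.+1 -> V) :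
  Dk k.+1 U g -> Dk k U g.
Proof.
elim: k g => // k IH g gD i; have [gd gpD] := gD i; split=> //.
exact: IH.
Qed.

Lemma Dk_cst k U (V : normedModType R) (a : V) : open U -> Dk k U (fun=> a).
Proof.
move=> oU; elim: k a => // k IH a.
by apply: (@Dk_rec _ _ _ _ (fun=> fun=> 0)).
Qed.

Lemma Dk_coord k U i : open U ->
  Dk k U (fun z : 'rV[R]_m.+1 => z 0 i).
Proof.
move=> oU; case: k => // k.
apply: (@Dk_rec _ _ _ _ (fun j _ => (delta_mx 0 j : 'rV[R]_m.+1) 0 i)) => //
  [j z _|j].
  exact: is_derive_coord.
exact: Dk_cst.
Qed.

Lemma Dk_id k U : open U ->
  Dk k U (fun z : 'rV[R]_m.+1 => z).
Proof.
move=> oU; case: k => // k.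
apply: (@Dk_rec _ _ _ _ (fun j _ => (delta_mx 0 j : 'rV[R]_m.+1))) => // j.
exact: Dk_cst.
Qed.

Lemma DkD k U (V : normedModType R) (f g : 'rV[R]_m.+1 -> V) : open U ->
  Dk k U f -> Dk k U g -> Dk k U (fun z => f z + g z).
Proof.
move=> oU; elim: k f g => // k IH f g fD gD.
apply: (@Dk_rec _ _ _ _ (fun i z => partial i f z + partial i g z)) => //.
  by move=> i z Uz; apply: is_deriveD; exact: Dk_is_derive Uz.
by move=> i; apply: IH; exact: Dk_partial.
Qed.

Lemma DkZ k U p q (a : 'rV[R]_m.+1 -> R) (u : 'rV[R]_m.+1 -> 'M[R]_(p, q)) :
  open U -> Dk k U a -> Dk k U u -> Dk k U (fun z => a z *: u z).
Proof.
move=> oU; elim: k a u => // k IH a u aD uD.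
apply: (@Dk_rec _ _ _ _
  (fun i z => partial i a z *: u z + a z *: partial i u z)) => //.
  by move=> i z Uz; apply: is_derive_scale; exact: Dk_is_derive Uz.
by move=> i; apply: DkD => //; apply: IH; solve [exact: Dk_partial | exact: Dk_pred].
Qed.

Lemma DkM k U (f g : 'rV[R]_m.+1 -> R) :
  open U -> Dk k U f -> Dk k U g -> Dk k U (fun z => f z * g z).
Proof.
move=> oU; elim: k f g => // k IH f g fD gD.
apply: (@Dk_rec _ _ _ _
  (fun i z => partial i f z * g z + f z * partial i g z)) => //.
  by move=> i z Uz; apply: is_derive_mul; exact: Dk_is_derive Uz.
by move=> i; apply: DkD => //; apply: IH; solve [exact: Dk_partial | exact: Dk_pred].
Qed.

Lemma Dk_dot k U n (u v : 'rV[R]_m.+1 -> 'rV[R]_n) :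
  open U -> Dk k U u -> Dk k U v -> Dk k U (fun z => dot (u z) (v z)).
Proof.
move=> oU; elim: k u v => // k IH f g fD gD.
apply: (@Dk_rec _ _ _ _
  (fun i z => dot (partial i f z) (g z) + dot (f z) (partial i g z))) => //.
  by move=> i z Uz; apply: is_derive_dot; exact: Dk_is_derive Uz.
by move=> i; apply: DkD => //; apply: IH; solve [exact: Dk_partial | exact: Dk_pred].
Qed.

Lemma DkV k U (a : 'rV[R]_m.+1 -> R) : open U -> (forall z, U z -> a z != 0) ->
  Dk k U a -> Dk k U (fun z => (a z)^-1).
Proof.
move=> oU a0; elim: k => // k IH aD.
have aD' := IH (Dk_pred aD).
apply: (@Dk_rec _ _ _ _
  (fun i z => -1 * partial i a z * ((a z)^-1 * (a z)^-1))) => // [i z Uz|i].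
  apply: is_derive_eq (is_derive_inv _ (Dk_is_derive i aD Uz)) _; first exact: a0.
  by rewrite mulN1r expr2 invfM.
by apply: DkM => //; apply: DkM => //; [exact: Dk_cst | exact: Dk_partial].
Qed.

Lemma Dk_expR k U (a : 'rV[R]_m.+1 -> R) : open U ->
  Dk k U a -> Dk k U (fun z => expR (a z)).
Proof.
move=> oU; elim: k => // k IH aD.
apply: (@Dk_rec _ _ _ _ (fun i z => expR (a z) * partial i a z)) => // [i z Uz|i].
  exact/is_derive_expR_comp/(Dk_is_derive _ aD).
by apply: DkM => //; [exact/IH/Dk_pred | exact: Dk_partial].
Qed.

End Dk.

(** * Symmetry of second derivatives *)

Section Schwarz.
Context {R : realType} {m : nat}.
Implicit Types (U : set 'rV[R]_m.+1) (z : 'rV[R]_m.+1).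

Lemma is_derive_along (V W : normedModType R) (g : V -> W) (dg : W)
    (z v : V) (t : R) :
  is_derive (t *: v + z) v g dg -> is_derive t 1 (fun s => g (s *: v + z)) dg.
Proof.
move=> /is_derive_line gd; apply/is_derive_line; move: gd.
by under eq_fun do rewrite addrA -scalerDl -[X in (X + t) *: _]mulr1.
Qed.

(** Two applications of the mean value theorem: first in direction i to the
increment of f in direction j, then in direction j to the i-th partial
derivative. The left-hand side is symmetric in i and j. *)
Lemma second_difference U (f : 'rV[R]_m.+1 -> R) i j z (h : R) :
  0 < h -> Dk 2 U f ->
  (forall s t, 0 <= s <= h -> 0 <= t <= h ->
     U (t *: delta_mx 0 j + (s *: delta_mx 0 i + z))) ->
  exists s t, [/\ 0 <= s <= h, 0 <= t <= h &
    f (h *: delta_mx 0 j + (h *: delta_mx 0 i + z)) - f (h *: delta_mx 0 i + z)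
      - f (h *: delta_mx 0 j + z) + f z =
    h ^+ 2 * partial j (partial i f)
               (t *: delta_mx 0 j + (s *: delta_mx 0 i + z))].
Proof.
move=> h0 fD Uz.
have hh : 0 <= h <= h by rewrite lexx ltW.
have h00 : (0:R) <= 0 <= h by rewrite lexx ltW.
pose ei : 'rV[R]_m.+1 := delta_mx 0 i; pose ej : 'rV[R]_m.+1 := delta_mx 0 j.
pose g s := f (s *: ei + (h *: ej + z)) - f (s *: ei + z).
pose dg s := partial i f (s *: ei + (h *: ej + z)) - partial i f (s *: ei + z).
have gd s : 0 <= s <= h -> is_derive s 1 g (dg s).
  move=> sh; apply: is_deriveB; apply: is_derive_along; apply: Dk_is_derive fD _.
    by rewrite addrCA; exact: Uz.
  by have := Uz s 0 sh h00; rewrite scale0r add0r.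
have gcont (u du : R -> R) : (forall s, 0 <= s <= h -> is_derive s 1 u (du s)) ->
    {within `[0, h], continuous u}.
  move=> ud; apply: derivable_within_continuous => s.
  by rewrite in_itv/= => /ud[].
have [||s] := @MVT R g dg 0 h h0.
- by move=> s; rewrite in_itv/= => /andP[s0 sh]; apply: gd; rewrite !ltW.
- exact: gcont gd.
rewrite in_itv/= subr0 => /andP[s0 sh] gE.
have {}sh : 0 <= s <= h by rewrite !ltW.
pose u t := partial i f (t *: ej + (s *: ei + z)).
pose du t := partial j (partial i f) (t *: ej + (s *: ei + z)).
have ud t : 0 <= t <= h -> is_derive t 1 u (du t).
  move=> th; apply: is_derive_along; apply: Dk_is_derive (Dk_partial i fD) _.
  exact: Uz.
have [||t] := @MVT R u du 0 h h0.
- by move=> t; rewrite in_itv/= => /andP[t0 th]; apply: ud; rewrite !ltW.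
- exact: gcont ud.
rewrite in_itv/= subr0 => /andP[t0 th] uE.
exists s, t; split=> //; first by rewrite !ltW.
have dgE : dg s = u h - u 0 by rewrite /dg /u addrCA scale0r add0r.
move: gE; rewrite dgE uE /g !scale0r !add0r -/ei -/ej (addrCA (h *: ej)).
rewrite -/(du t) => gE; have -> : h ^+ 2 * du t = du t * h * h by ring.
by rewrite -gE; ring.
Qed.

Lemma norm_delta_le1 i : `|delta_mx 0 i : 'rV[R]_m.+1| <= 1.
Proof.
rewrite [leLHS]/Num.Def.normr/= mx_normrE; apply: bigmax_le => // k _.
by rewrite mxE; case: (_ && _); rewrite ?normr1 ?normr0.
Qed.

(** The symmetric second difference is h^2 times either mixed derivative, each
evaluated at some point within O(h) of z; continuity at z lets h tend to 0. *)
Theorem schwarz U (f : 'rV[R]_m.+1 -> R) i j z : open U -> U z -> Ck 2 U f ->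
  partial i (partial j f) z = partial j (partial i f) z.
Proof.
move=> oU Uz fC; have fD := Ck_Dk fC.
have cont k l : {for z, continuous (partial k (partial l f))}.
  by case: fC => _ /(_ l)[_ [_ /(_ k)[_ [+ _]]]]; exact.
have diff (h : R) k l := @second_difference U f k l z h ^~ fD.
have {diff fD fC} := (cont i j, cont j i, fun h => diff h j i, fun h => diff h i j).
(* From here on only continuity at z and the two difference formulas matter. *)
move: (partial i (partial j f)) (partial j (partial i f)) => A B.
case=> [[[cA cB] dA] dB].
apply/eqP; rewrite -subr_eq0 -normr_eq0 eq_le normr_ge0 andbT.
apply/ler_addgt0Pl => e e0; rewrite addr0 ltW//.
have e2 : 0 < e / 2 by rewrite divr_gt0.
have nU : nbhs z U by apply: open_nbhs_nbhs.
have /cvgrPdist_lt/(_ _ e2) nA := cA.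
have /cvgrPdist_lt/(_ _ e2) nB := cB.
have : \forall y \near z,
    U y /\ (`|A z - A y| < e / 2 /\ `|B z - B y| < e / 2).
  exact: filterI nU (filterI nA nB).
move=> /nbhs_ballP[r /= r0 rP].
have h0 : 0 < r / 3 by rewrite divr_gt0.
have inball k l s t : 0 <= s <= r / 3 -> 0 <= t <= r / 3 ->
    ball z r (t *: delta_mx 0 k + (s *: delta_mx 0 l + z)).
  move=> /andP[s0 sh] /andP[t0 th].
  rewrite -ball_normE/= addrA opprD addrCA subrr addr0 normrN.
  apply: (le_lt_trans (ler_normD _ _)); rewrite !normrZ !ger0_norm//.
  have := ler_piMr s0 (norm_delta_le1 l); have := ler_piMr t0 (norm_delta_le1 k).
  by lra.
have Uin k l s t : 0 <= s <= r / 3 -> 0 <= t <= r / 3 ->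
    U (t *: delta_mx 0 k + (s *: delta_mx 0 l + z)).
  by move=> sh th; case: (rP _ (inball k l s t sh th)).
have [s [t [sh th E1]]] := dA _ h0 (Uin i j).
have [s' [t' [sh' th' E2]]] := dB _ h0 (Uin j i).
have [_ [a _]] := rP _ (inball i j s t sh th).
have [_ [_ b]] := rP _ (inball j i s' t' sh' th').
move: E2; rewrite addrCA (addrAC (f _)) E1 => /mulfI E2.
rewrite -E2 in b; last by rewrite expf_neq0// gt_eqF.
by move: a b; rewrite !ltr_norml; lra.
Qed.

End Schwarz.

(** * Reflections and inversions *)

Section Reflection.
Context {R : realType} {n : nat}.
Implicit Types u v w : 'rV[R]_n.

Definition reflection w v : 'rV[R]_n := v - (2 * dot w v / dot w w) *: w.

Lemma dot_reflectionl w u v : dot (reflection w u) v = dot u (reflection w v).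
Proof. by rewrite /reflection !dotE (dotC u w); ring. Qed.

Lemma reflection_isometry w u v : dot w w != 0 ->
  dot (reflection w u) (reflection w v) = dot u v.
Proof. by move=> w0; rewrite /reflection !dotE (dotC u w); field. Qed.

Lemma reflection_mx w v :
  reflection w v = v *m (1%:M - (2 / dot w w) *: (w^T *m w)).
Proof.
rewrite mulmxBr mulmx1 -scalemxAr mulmxA mulmx_dot mul_scalar_mx scalerA.
by rewrite /reflection (dotC w v) mulrAC.
Qed.

(** The differential of u |-> 2 u / |u|^2 at w is (2 / |w|^2) times the
reflection in w. The term dtheta is put under the same reflection by means of
u = reflection w (u - (2 <w, u> / |w|^2) w). *)
Lemma is_derive_inversion (V : normedModType R) (theta w : V -> 'rV[R]_n)
    (dtheta dw : 'rV[R]_n) (z v : V) : dot (w z) (w z) != 0 ->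
  is_derive z v theta dtheta -> is_derive z v w dw ->
  is_derive z v (fun y => theta y + (2 / dot (w y) (w y)) *: w y)
    ((2 / dot (w z) (w z)) *: reflection (w z)
       ((dot (w z) (w z) / 2) *: dtheta - dot (w z) dtheta *: w z + dw)).
Proof.
move=> w0 dth dW.
have dM := is_derive_inv (a := fun y => dot (w y) (w y)) w0 (is_derive_dot dW dW).
have d2M := is_derive_mul (is_derive_cst (2:R) z v) dM.
apply: is_derive_eq (is_deriveD dth (is_derive_scale d2M dW)) _.
rewrite /reflection !dotE (dotC dw); set M := dot (w z) (w z) in w0 *.
by apply/rowP => k; rewrite !mxE; field.
Qed.

(** With theta + (2 / |w|^2) w for the envelope and a = e^rho, the left-hand side
is the radius of the horosphere at the point of contact. Being a reflected
multiple of theta, it is orthogonal to every reflected vector orthogonal to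
theta. *)
Lemma radius_reflection (a : R) (theta w : 'rV[R]_n) : a + 1 != 0 ->
  dot w theta = - (a + 1) ->
  (a / (a + 1)) *: theta - (theta + (2 / dot w w) *: w) =
  - (a + 1)^-1 *: reflection w theta.
Proof.
move=> a1 wth; rewrite /reflection wth.
apply/rowP => k; rewrite !mxE; by set M := (dot w w)^-1; field.
Qed.
End Reflection.

(** * The hyperbolic metric and its horospheres *)

Section LeviCivita.
Context {R : realType}.
Implicit Types x u v : 'rV[R]_3.

Lemma hyp_mxE x : hyp_mx x = (4 / (1 - dot x x) ^+ 2)%:M.
Proof.
apply/matrixP => i j; rewrite !mxE /hyp dot_delta mxE eqxx/= eq_sym.
by rewrite -mulr_natr; ring.
Qed.

Lemma is_derive_hyp_mx x i j l : dot x x != 1 ->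
  is_derive x (delta_mx 0 i) (fun y => hyp_mx y j l)
    ((j == l)%:R * (16 * x 0 i / (1 - dot x x) ^+ 3)).
Proof.
move=> x1; have q0 : 1 - dot x x != 0 by rewrite subr_eq0 eq_sym.
have dx := is_derive_id x (delta_mx 0 i); have dq := is_derive_dot dx dx.
have {}dq := is_deriveB (is_derive_cst (1 : R) x (delta_mx 0 i)) dq.
have {}dq := is_derive_mul dq dq.
have dc := is_derive_cst ((j == l)%:R * 4 : R) x (delta_mx 0 i).
rewrite (_ : (fun y => _) =
  fun y => (j == l)%:R * 4 * ((1 - dot y y) * (1 - dot y y))^-1); last first.
  by apply/funext => y; rewrite hyp_mxE mxE -mulr_natl -expr2; ring.
apply: is_derive_eq (is_derive_mul dc (is_derive_inv _ dq)) _.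
  by rewrite mulf_neq0.
rewrite (dotC (delta_mx _ _)) dot_delta /=.
rewrite /cst; have -> : (1 - fun y : 'rV[R]_3 => dot y y) x = 1 - dot x x by [].
by field.
Qed.

(** The usual Christoffel symbols of a conformally flat metric phi |dx|^2, with
d phi / (2 phi) = 2 x / (1 - |x|^2). *)
Lemma christoffelE x k i j : dot x x != 1 ->
  christoffel x k i j = 2 / (1 - dot x x) *
    ((k == j)%:R * x 0 i + (k == i)%:R * x 0 j - (i == j)%:R * x 0 k).
Proof.
move=> x1; have q0 : 1 - dot x x != 0 by rewrite subr_eq0 eq_sym.
rewrite /christoffel hyp_mxE invmx_scalar.
set c := (4 / _)^-1.
rewrite (eq_bigr (fun l => (k == l)%:R * (c * (16 / (1 - dot x x) ^+ 3 *
   ((j == l)%:R * x 0 i + (i == l)%:R * x 0 j - (i == j)%:R * x 0 l))))).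
  by rewrite sum_delta /c !(eq_sym k); field.
move=> l _; have -> : c%:M k l = (k == l)%:R * c by rewrite mxE mulr_natl.
rewrite -mulrA; congr (_ * (_ * _)).
rewrite /partial.
have [_ ->] := is_derive_hyp_mx i j l x1.
have [_ ->] := is_derive_hyp_mx j i l x1.
have [_ ->] := is_derive_hyp_mx l i j x1.
by ring.
Qed.

Lemma christoffel_row x u v : dot x x != 1 ->
  \row_k \sum_(a < 3) \sum_(b < 3) christoffel x k a b * u 0 a * v 0 b =
  (2 / (1 - dot x x)) *: (dot x u *: v + dot x v *: u - dot u v *: x).
Proof.
move=> x1; apply/rowP => k; rewrite !mxE; set mu := 2 / _.
transitivity (\sum_(a < 3) mu * (x 0 a * u 0 a * v 0 k
   + (k == a)%:R * (u 0 a * dot x v) - u 0 a * v 0 a * x 0 k)).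
  apply: eq_bigr => a _.
  transitivity (\sum_(b < 3) mu * ((k == b)%:R * (x 0 a * u 0 a * v 0 b)
   + ((k == a)%:R * u 0 a) * (x 0 b * v 0 b)
   - (a == b)%:R * (u 0 a * v 0 b * x 0 k))).
    by apply: eq_bigr => b _; rewrite christoffelE// -/mu; ring.
  rewrite -mulr_sumr !big_split/= sumrN !sum_delta -mulr_sumr -/(dot x v).
  by rewrite !mulrA.
rewrite -mulr_sumr !big_split/= sumrN sum_delta -!mulr_suml.
by rewrite -/(dot x u) -/(dot u v); congr (_ * _); rewrite (mulrC (u 0 k)).
Qed.

(** As N is normal to the surface, only the last of the three terms of
christoffel_row contributes. *)
Lemma hyp_cov_deriv (X : 'rV[R]_2 -> 'rV[R]_3) z i j (N : 'rV[R]_3) :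
  dot (X z) (X z) != 1 ->
  dot (partial i X z) N = 0 -> dot (partial j X z) N = 0 ->
  hyp (X z) (cov_deriv X z j i) N =
  4 / (1 - dot (X z) (X z)) ^+ 2 *
  (dot (partial j (partial i X) z) N
   - 2 / (1 - dot (X z) (X z)) * dot (partial i X z) (partial j X z)
     * dot (X z) N).
Proof.
rewrite /hyp /cov_deriv => x1; rewrite christoffel_row//.
move: (partial j (partial i X) z) (partial i X z) (partial j X z) => Xij Xi Xj.
by move=> iN jN; rewrite !dotE iN jN (dotC Xi); ring.
Qed.
End LeviCivita.

Lemma expR1_neq0 {R : realType} (s : R) : expR s + 1 != 0.
Proof. by rewrite gt_eqF// addr_gt0// expR_gt0. Qed.

Lemma horosphere_centerE {R : realType} (t : 'rV[R]_3) (s : R) :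
  horosphere_center t s = (expR s / (expR s + 1)) *: t.
Proof.
have := expR1_neq0 s; rewrite /horosphere_center => a1.
by congr (_ *: _); field.
Qed.

(** The hypothesis on r says that x lies on the horosphere, whose Euclidean
radius is (e^s + 1)^-1. The component of N orthogonal to r vanishes, as it is
tangent to the horosphere and orthogonal to N; the unit length and the
orientation of N then fix the factor. *)
Lemma horosphere_normalE {R : realType} (theta : 'rV[R]_3) (s : R) (x N : 'rV[R]_3) :
  let r := horosphere_center theta s - x in
  dot x x < 1 -> dot r r = ((expR s + 1)^-1) ^+ 2 ->
  is_horosphere_normal theta s x N ->
  N = ((expR s + 1) * (1 - dot x x) / 2) *: r.
Proof.
rewrite /is_horosphere_normal /=; move: (horosphere_center theta s - x) => r.
move=> x1 rr [NN NT Nr]; have a1 : 0 < expR s + 1 by rewrite addr_gt0// expR_gt0.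
have q0 : 0 < 1 - dot x x by rewrite subr_gt0.
have r0 : 0 < dot r r by rewrite rr exprn_gt0// invr_gt0.
pose k := dot N r / dot r r.
have k0 : 0 < k by rewrite divr_gt0.
have Nk : N = k *: r.
  apply/eqP; rewrite -subr_eq0; apply/eqP/dot_eq0.
  have vr : dot (N - k *: r) r = 0 by rewrite !dotE /k divfK ?subrr// gt_eqF.
  have /eqP := NT _ vr; rewrite /hyp mulf_eq0 invr_eq0 expf_eq0/= (gt_eqF q0) orbF.
  rewrite mulf_eq0 pnatr_eq0/= => /eqP vN.
  by rewrite [LHS]dotDr vN dotNr dotZr vr mulr0 subrr.
clearbody k; rewrite Nk; congr (_ *: _); apply/eqP.
rewrite -(@eqrXn2 _ 2)//; last by rewrite ltW// divr_gt0// mulr_gt0.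
  apply/eqP; move: NN; rewrite Nk /hyp !dotE rr => NN.
  have : k ^+ 2 * 4 = ((expR s + 1) * (1 - dot x x)) ^+ 2.
    move/(congr1 (fun t => ((expR s + 1) * (1 - dot x x)) ^+ 2 * t)) : NN.
    by rewrite mulr1 => <-; field; rewrite !gt_eqF.
  by move=> E; rewrite exprMn -E; field.
exact: ltW.
Qed.

(** * The stereographic chart *)

Section Frame.
Context {R : realType} (p : 'rV[R]_3) (e : 'M[R]_(2, 3)).
Hypotheses (pS : sphere2 p) (pe : tangent_frame p e).

Lemma dot_frame (u v : 'rV[R]_2) : dot (u *m e) (v *m e) = dot u v.
Proof.
have : ((u *m e) *m (v *m e)^T) 0 0 = (u *m v^T) 0 0.
  by rewrite trmx_mul mulmxA -(mulmxA u) (proj1 pe) mulmx1.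
by rewrite !mulmx_dot !mxE eqxx !mulr1n.
Qed.

Lemma dot_base_frame (v : 'rV[R]_2) : dot p (v *m e) = 0.
Proof.
have : (p *m (v *m e)^T) 0 0 = 0.
  by rewrite trmx_mul mulmxA (proj2 pe) mul0mx mxE.
by rewrite mulmx_dot !mxE eqxx !mulr1n.
Qed.

Lemma dot_frame_base (v : 'rV[R]_2) : dot (v *m e) p = 0.
Proof. by rewrite dotC dot_base_frame. Qed.

(** The matrix with rows p and e is orthogonal: a one-sided inverse of a square
matrix is two-sided. *)
Lemma frame_expansion (v : 'rV[R]_3) :
  v = dot v p *: p + \sum_(i < 2) dot v (row i e) *: row i e.
Proof.
have QQ : col_mx p e *m row_mx p^T e^T = 1%:M :> 'M[R]_(1 + 2).
  rewrite mul_col_row mulmx_dot (proj1 pe) (proj2 pe).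
  have -> : e *m p^T = 0 by rewrite -[LHS]trmxK trmx_mul trmxK (proj2 pe) trmx0.
  by rewrite (pS : dot p p = 1) -scalar_mx_block.
rewrite -{1}[v]mulmx1 -(mulmx1C QQ) mulmxA mul_mx_row mul_row_col mulmx_dot.
rewrite mul_scalar_mx mulmx_sum_row; congr (_ + _); apply: eq_bigr => i _.
by congr (_ *: _); rewrite mxE; apply: eq_bigr => k _; rewrite !mxE.
Qed.

(** The round metric is conformal(z)^2 |dz|^2 in the chart. *)
Definition conformal (z : 'rV[R]_2) : R := 4 / (4 + dot z z).

Lemma four_dot_gt0 (z : 'rV[R]_2) : 0 < 4 + dot z z.
Proof. by rewrite ltr_wpDr// dot_ge0. Qed.

Lemma conformal_gt0 z : 0 < conformal z.
Proof. by rewrite divr_gt0// four_dot_gt0. Qed.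

Lemma stereo_sphere z : sphere2 (stereo p e z).
Proof.
have := four_dot_gt0 z => q0.
rewrite /sphere2/= /stereo !dotE dot_frame dot_base_frame dot_frame_base.
by rewrite (pS : dot p p = 1); field; rewrite gt_eqF.
Qed.

Definition dstereo (i : 'I_2) (z : 'rV[R]_2) : 'rV[R]_3 :=
  conformal z *: row i e
  - (conformal z ^+ 2 / 2 * z 0 i) *: (2 *: p + z *m e).

Lemma is_derive_conformal z (v : 'rV[R]_2) :
  is_derive z v conformal (- (conformal z ^+ 2 / 2 * dot z v)).
Proof.
have q0 := four_dot_gt0 z.
have dq := is_derive_dot (is_derive_id z v) (is_derive_id z v).
have {}dq := is_deriveD (is_derive_cst (4 : R) z v) dq.
have {}dq := @is_derive_inv _ _ (fun y => 4 + dot y y) _ _ _ _ dq.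
have {}dq := is_derive_mul (is_derive_cst (4 : R) z v) (dq _).
apply: is_derive_eq (dq _) _; first by rewrite gt_eqF.
by rewrite (dotC v) /conformal; field; rewrite gt_eqF.
Qed.

Lemma is_derive_mulmx z (v : 'rV[R]_2) :
  is_derive z v (fun y => y *m e) (v *m e).
Proof.
apply/is_derive_mxP => i j; rewrite mxE ord1.
rewrite (_ : (fun y => _) = \sum_(k < 2) (fun y : 'rV[R]_2 => y 0 k * e k j)).
  apply: is_derive_sum => k.
  apply: is_derive_eq (is_derive_mul (is_derive_coord z v k)
    (is_derive_cst (e k j) z v)) _.
  by rewrite mulr0 addr0.
by apply/funext => y; rewrite fct_sumE mxE.
Qed.

Lemma is_derive_stereo i z :
  is_derive z (delta_mx 0 i) (stereo p e) (dstereo i z).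
Proof.
have d1 := is_derive_mulmx z (delta_mx 0 i).
have {}d1 := is_deriveD (is_derive_cst (2 *: p) z (delta_mx 0 i)) d1.
have {}d1 := is_derive_scale (is_derive_conformal z (delta_mx 0 i)) d1.
have {}d1 := is_deriveD (is_derive_cst (- p) z (delta_mx 0 i)) d1.
apply: is_derive_eq d1 _.
by rewrite dot_delta !add0r -rowE scaleNr addrC.
Qed.

Lemma partial_stereo i : partial i (stereo p e) = dstereo i.
Proof. by apply/funext => z; have [_] := is_derive_stereo i z. Qed.

Lemma dot_stereo_dstereo z i : dot (stereo p e z) (dstereo i z) = 0.
Proof.
have q0 := four_dot_gt0 z.
rewrite /stereo /dstereo !rowE !dotE !dot_frame !dot_base_frame.
rewrite dot_frame_base (pS : dot p p = 1) dot_delta /conformal.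
by field; rewrite gt_eqF.
Qed.

Lemma dot_dstereo z i j :
  dot (dstereo i z) (dstereo j z) = conformal z ^+ 2 * (i == j)%:R.
Proof.
have q0 := four_dot_gt0 z.
rewrite /dstereo !rowE !dotE !dot_frame !dot_base_frame !dot_frame_base.
rewrite (pS : dot p p = 1) (dotC _ z) !dot_delta mxE eqxx/= eq_sym /conformal.
by field; rewrite gt_eqF.
Qed.

(** The normalized coordinate fields form a frame at every point of the chart,
so frame_expansion applies along the surface and not only at p. *)
Lemma tangent_frame_dstereo z : tangent_frame (stereo p e z)
  ((conformal z)^-1 *: \matrix_(i < 2) dstereo i z).
Proof.
have c0 := conformal_gt0 z.
split; apply/matrixP => i j; rewrite mxE.
- transitivity (dot ((conformal z)^-1 *: dstereo i z)
                    ((conformal z)^-1 *: dstereo j z)).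
    by apply: eq_bigr => k _; rewrite !mxE.
  rewrite dotZl dotZr dot_dstereo mxE; case: eqP => _; last by rewrite !mulr0.
  by field; rewrite gt_eqF.
- transitivity (dot (stereo p e z) ((conformal z)^-1 *: dstereo j z)).
    by apply: eq_bigr => k _; rewrite !mxE ord1.
  by rewrite dotZr dot_stereo_dstereo mulr0 mxE.
Qed.

Lemma Dk_conformal k (U : set 'rV[R]_2) : open U -> Dk k U conformal.
Proof.
move=> oU; apply: (@DkM _ _ _ _ (fun=> 4)) => //; first exact: Dk_cst.
apply: DkV => //; first by move=> z _; rewrite gt_eqF// four_dot_gt0.
by apply: DkD => //; [exact: Dk_cst|apply: Dk_dot => //; exact: Dk_id].
Qed.

Lemma Dk_stereo k (U : set 'rV[R]_2) : open U -> Dk k U (stereo p e).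
Proof.
move=> oU; apply: DkD => //; first exact: Dk_cst.
apply: DkZ => //; first exact: Dk_conformal.
apply: DkD => //; first exact: Dk_cst.
apply: (@Dk_ext _ _ _ _ _ (fun z => z 0 0 *: row 0 e + z 0 1 *: row 1 e)) => //.
  by move=> z _; rewrite mulmx_sum_row sum2.
by apply: DkD => //; apply: DkZ => //; solve [exact: Dk_coord | exact: Dk_cst].
Qed.

Lemma continuous_mulmx : continuous (fun z : 'rV[R]_2 => z *m e).
Proof.
rewrite (_ : (fun z => _) = fun z : 'rV[R]_2 => z 0 0 *: row 0 e + z 0 1 *: row 1 e).
  by move=> z; apply: (@continuousD R _ _ (fun y : 'rV[R]_2 => y 0 0 *: row 0 e)
    (fun y : 'rV[R]_2 => y 0 1 *: row 1 e));
    apply: continuousZr_tmp; exact: coord_continuous.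
by apply/funext => z; rewrite mulmx_sum_row sum2.
Qed.

Lemma continuous_stereo : continuous (stereo p e).
Proof.
have dotc : continuous (fun z : 'rV[R]_2 => dot z z).
  rewrite (_ : (fun z => _) = fun z : 'rV[R]_2 => z 0 0 * z 0 0 + z 0 1 * z 0 1).
    by move=> z; apply: (@continuousD R R^o _ (fun y : 'rV[R]_2 => y 0 0 * y 0 0)
      (fun y : 'rV[R]_2 => y 0 1 * y 0 1)); apply: continuousM;
      exact: coord_continuous.
  by apply/funext => z; rewrite /dot sum2.
move=> z; apply: (@continuousD R _ _ (cst (- p))
  (fun y => conformal y *: (2 *: p + y *m e))); first exact: cst_continuous.
apply: (@continuousZ _ _ _ conformal (fun y => 2 *: p + y *m e)).
  apply: (@continuousM _ _ (cst 4) (fun y => (4 + dot y y)^-1)).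
    exact: cst_continuous.
  apply: (@continuousV _ _ (fun y => 4 + dot y y)).
    by rewrite gt_eqF// four_dot_gt0.
  apply: (@continuousD R R^o _ (cst 4) (fun y : 'rV[R]_2 => dot y y)).
    exact: cst_continuous.
  exact: dotc.
apply: (@continuousD R _ _ (fun=> 2 *: p) (fun y : 'rV[R]_2 => y *m e)).
  exact: cst_continuous.
exact: continuous_mulmx.
Qed.

Lemma conformal0 : conformal 0 = 1.
Proof. by rewrite /conformal dot0 addr0 divff. Qed.

Lemma stereo0 : stereo p e 0 = p.
Proof.
rewrite /stereo mul0mx dot0 !addr0.
by rewrite divff// scale1r scaler_nat mulr2n addKr.
Qed.

Lemma dstereo0 i : dstereo i 0 = row i e.
Proof.
by rewrite /dstereo mxE mulr0 scale0r subr0 conformal0 scale1r.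
Qed.

(** The Christoffel symbols of the chart vanish at p: second derivatives of the
chart there are normal to the sphere. *)
Lemma is_derive_dstereo0 i j :
  is_derive 0 (delta_mx 0 j) (dstereo i) (- (i == j)%:R *: p).
Proof.
pose v : 'rV[R]_2 := delta_mx 0 j.
have dc := is_derive_conformal 0 v.
have d1 := is_derive_scale dc (is_derive_cst (row i e) 0 v).
have d2 := is_derive_mul dc dc.
have {}d2 := is_derive_mul d2 (is_derive_cst (2^-1 : R) 0 v).
have {}d2 := is_derive_mul d2 (is_derive_coord 0 v i).
have dl : is_derive (0 : 'rV[R]_2) v (fun y => 2 *: p + y *m e) (v *m e).
  apply: is_derive_eq (is_deriveD (is_derive_cst (2 *: p) _ v)
    (is_derive_mulmx 0 v)) _; exact: add0r.
apply: is_derive_eq (is_deriveB d1 (is_derive_scale d2 dl)) _.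
rewrite /cst/= conformal0 dot0 mul0mx addr0 !mxE eqxx/=.
by apply/rowP => k; rewrite !mxE; field.
Qed.
End Frame.

(* Keeps unification from unfolding partial derivatives to limits. *)
Local Opaque partial Dk Ck derive derivable.

(** * The envelope in the chart *)

Section Envelope.
Context {R : realType} (Omega : set 'rV[R]_3) (rho : 'rV[R]_3 -> R)
  (Drho : 'rV[R]_3 -> 'rV[R]_3) (p : 'rV[R]_3) (e : 'M[R]_(2, 3)).
Hypotheses (OmegaD : sphere_domain Omega) (rhoC : Ck_on_sphere 3 Omega rho)
  (rhoG : forall theta, Omega theta -> is_sphere_gradient rho theta (Drho theta))
  (Omegap : Omega p) (pe : tangent_frame p e).

Let theta := stereo p e.
Let U : set 'rV[R]_2 := theta @^-1` Omega.
Let f : 'rV[R]_2 -> R := rho \o theta.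

Lemma base_sphere : sphere2 p.
Proof. by case: OmegaD => -[V _ OV] _ _; move: Omegap; rewrite OV => -[]. Qed.
Let pS := base_sphere.

Lemma chart_open : open U.
Proof.
case: OmegaD => -[V oV OV] _ _; rewrite (_ : U = theta @^-1` V).
  by apply: open_comp oV => z _; exact: continuous_stereo.
apply/seteqP; split => z; rewrite /U OV /=; first by case.
move=> Vz; split=> //.
exact: stereo_sphere.
Qed.
Let oU := chart_open.

Lemma chart0 : U 0. Proof. by rewrite /U/= /theta stereo0. Qed.
Let U0 := chart0.

Lemma height_Ck : Ck 3 U f. Proof. exact: rhoC. Qed.
Let fD : Dk 3 U f := Ck_Dk height_Ck.

(** The defining property of the gradient, tested on coordinate lines. *)
Lemma height_partial i z : U z ->
  partial i f z = dot (Drho (theta z)) (dstereo p e i z).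
Proof.
move=> Uz; apply: is_derive_partial; apply/is_derive_line.
have [_ grad] := rhoG Uz.
apply: (grad (fun t => theta (t *: delta_mx 0 i + z))).
- by move=> t; exact: stereo_sphere.
- by rewrite scale0r add0r.
- exact: (is_derive_line _ _ _ _).1 (is_derive_stereo p e i z).
Qed.

(** This formula is what makes Drho differentiable along the chart: Drho itself
is only given pointwise. *)
Lemma gradient_chart z : U z ->
  Drho (theta z) = \sum_(i < 2)
    ((conformal z)^-1 * (conformal z)^-1 * partial i f z) *: dstereo p e i z.
Proof.
move=> Uz; have [tD _] := rhoG Uz.
rewrite [LHS](frame_expansion (stereo_sphere pS pe z)
  (tangent_frame_dstereo pS pe z)).
rewrite dotC tD scale0r add0r; apply: eq_bigr => i _.
rewrite (_ : row i _ = (conformal z)^-1 *: dstereo p e i z); last first.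
  by apply/rowP => k; rewrite !mxE.
by rewrite dotZr scalerA height_partial// mulrAC.
Qed.

(** Twice the image of envelope - theta under the inversion u |-> u / |u|^2; this
is the vector W of the introduction. *)
Definition inverse_offset (z : 'rV[R]_2) : 'rV[R]_3 :=
  Drho (theta z) - (expR (f z) + 1) *: theta z.
Local Notation W := inverse_offset.

Lemma Dk_inverse_offset : Dk 2 U W.
Proof.
apply: (@Dk_ext _ _ _ _ _ (fun z =>
   (((conformal z)^-1 * (conformal z)^-1 * partial 0 f z) *: dstereo p e 0 z
  + ((conformal z)^-1 * (conformal z)^-1 * partial 1 f z) *: dstereo p e 1 z)
  + (-1 * (expR (f z) + 1)) *: theta z) _ oU).
  by move=> z Uz; rewrite /W gradient_chart// sum2 mulN1r scaleNr.
have Dth : Dk 3 U theta by exact: Dk_stereo.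
have Dd i : Dk 2 U (dstereo p e i) by rewrite -partial_stereo; exact: Dk_partial.
have Dc : Dk 2 U (fun z : 'rV[R]_2 => (conformal z)^-1).
  apply: DkV => //; first by move=> z _; rewrite gt_eqF// conformal_gt0.
  exact: Dk_conformal.
have Dg i : Dk 2 U (fun z : 'rV[R]_2 =>
    ((conformal z)^-1 * (conformal z)^-1 * partial i f z) *: dstereo p e i z).
  apply: (DkZ oU _ (Dd i)).
  apply: (DkM oU _ (Dk_partial i fD)).
  exact: (DkM oU Dc Dc).
apply: (DkD oU (DkD oU (Dg 0) (Dg 1))).
apply: (DkZ oU _ (Dk_pred Dth)).
apply: (DkM oU (Dk_cst _ _ oU)).
apply: (DkD oU _ (Dk_cst _ _ oU)).
exact: (Dk_expR oU (Dk_pred fD)).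
Qed.

Lemma dot_inverse_offset_base z : U z -> dot (W z) (theta z) = - (expR (f z) + 1).
Proof.
move=> Uz; have [tD _] := rhoG Uz.
rewrite /W dotDl dotNl dotZl dotC tD.
by rewrite (stereo_sphere pS pe z : dot _ _ = 1) add0r mulr1.
Qed.

Lemma dot_inverse_offset_dstereo z i : U z ->
  dot (W z) (dstereo p e i z) = partial i f z.
Proof.
move=> Uz; rewrite /W dotDl dotNl dotZl -height_partial//.
by rewrite (dot_stereo_dstereo pS pe) mulr0 subr0.
Qed.

Lemma dot_inverse_offsetE z : U z ->
  dot (W z) (W z) = dot (Drho (theta z)) (Drho (theta z)) + (expR (f z) + 1) ^+ 2.
Proof.
move=> Uz; have [tD _] := rhoG Uz.
have tt : dot (theta z) (theta z) = 1 := stereo_sphere pS pe z.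
rewrite /W; move: (theta z) (Drho _) (expR _) tD tt => t D a tD tt.
by rewrite !dotE (dotC D t) tD tt; ring.
Qed.

Lemma inverse_offset_gt0 z : U z -> 0 < dot (W z) (W z).
Proof.
by move=> Uz; rewrite dot_inverse_offsetE// ltr_wpDl ?dot_ge0// exprn_even_gt0.
Qed.

Lemma inverse_offset_neq0 z : U z -> dot (W z) (W z) != 0.
Proof. by move=> Uz; rewrite gt_eqF// inverse_offset_gt0. Qed.

Let X := envelope rho Drho \o theta.

Lemma envelopeE z : U z -> X z = theta z + (2 / dot (W z) (W z)) *: W z.
Proof.
move=> Uz; have := inverse_offset_neq0 Uz; rewrite dot_inverse_offsetE// => M0.
rewrite /X /envelope /= -![rho (theta z)]/(f z); move: M0.
have -> : expR (2 * f z) = expR (f z) ^+ 2 by rewrite expRM_natl.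
rewrite /W.
move: (theta z) (Drho _) (expR _) => t D a; move: (dot D D) => d M0.
by apply/rowP => k; rewrite !mxE; field.
Qed.

Lemma Dk_envelope : Dk 2 U X.
Proof.
have DW := Dk_inverse_offset.
apply: (@Dk_ext _ _ _ _ _
  (fun z => theta z + (2 * (dot (W z) (W z))^-1) *: W z) _ oU).
  by move=> z Uz; rewrite envelopeE.
have Dth : Dk 2 U theta := Dk_stereo p e 2 oU.
apply: (DkD oU Dth).
apply: (DkZ oU _ DW); apply: (DkM oU (Dk_cst _ _ oU)).
by apply: (DkV oU _ (Dk_dot oU DW DW)) => z; exact: inverse_offset_neq0.
Qed.

(** The tangent vector X_i of the envelope, up to the factor 2 / |W|^2 and before
the reflection in W. *)
Definition unreflected i z : 'rV[R]_3 :=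
  (dot (W z) (W z) / 2) *: dstereo p e i z - partial i f z *: W z
  + partial i W z.
Local Notation V := unreflected.

Lemma envelope_partial i z : U z ->
  partial i X z = (2 / dot (W z) (W z)) *: reflection (W z) (V i z).
Proof.
move=> Uz; apply: is_derive_partial.
have E y : U y -> theta y + (2 / dot (W y) (W y)) *: W y = X y.
  by move=> Uy; rewrite envelopeE.
apply: (is_derive_open_eq oU Uz E).
have := is_derive_inversion (inverse_offset_neq0 Uz) (is_derive_stereo p e i z)
  (Dk_is_derive i Dk_inverse_offset Uz).
by rewrite dot_inverse_offset_dstereo.
Qed.

(** Differentiate <W, theta> = - (e^f + 1) and use <W, theta_i> = f_i. *)
Lemma partial_inverse_offset_base i z : U z ->
  dot (partial i W z) (theta z) = - (expR (f z) + 1) * partial i f z.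
Proof.
move=> Uz.
have dW := is_derive_dot (Dk_is_derive i Dk_inverse_offset Uz)
  (is_derive_stereo p e i z).
have da := is_derive_expR_comp (Dk_is_derive i fD Uz).
have {}da := is_deriveN (is_deriveD da (is_derive_cst (1 : R) z (delta_mx 0 i))).
have := is_derive_open_unique oU Uz dot_inverse_offset_base dW da.
rewrite dot_inverse_offset_dstereo// => E.
by apply: (addIr (partial i f z)); rewrite E; ring.
Qed.

(** This is the envelope condition: it makes the horosphere tangent to the
surface. *)
Lemma dot_unreflected_base i z : U z -> dot (V i z) (theta z) = 0.
Proof.
move=> Uz; rewrite /V dotDl partial_inverse_offset_base// dotDl dotZl dotNl dotZl.
rewrite dot_inverse_offset_base// dotC (dot_stereo_dstereo pS pe).
by ring.
Qed.

(** The Euclidean radius of the horosphere, which is proportional to the normal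
N of the surface. *)
Definition radius z : 'rV[R]_3 := horosphere_center (theta z) (f z) - X z.

Lemma radiusE z : U z ->
  radius z = - (expR (f z) + 1)^-1 *: reflection (W z) (theta z).
Proof.
move=> Uz; rewrite /radius horosphere_centerE envelopeE//.
by apply: radius_reflection; [exact: expR1_neq0|exact: dot_inverse_offset_base].
Qed.

Lemma radius_normal i z : U z -> dot (partial i X z) (radius z) = 0.
Proof.
move=> Uz; rewrite envelope_partial// radiusE// dotZl dotZr.
rewrite reflection_isometry ?inverse_offset_neq0// dot_unreflected_base//.
by rewrite !mulr0.
Qed.

(** The coordinates of unreflected i at p in the frame e. The factor
|W|^2 / 2 - (e^rho + 1) of the identity is (|d rho|^2 + e^(2 rho) - 1) / 2, so
this is the matrix with entries E, F, F, G plus (e^(2 rho) / 2) Id. *)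
Definition tangent_coef i k : R :=
  partial i (partial k f) 0 - partial i f 0 * partial k f 0
  + (dot (W 0) (W 0) / 2 - (expR (rho p) + 1)) * (i == k)%:R.

Lemma height0 : f 0 = rho p.
Proof. by rewrite /f/= /theta stereo0. Qed.

Lemma dot_inverse_offset_p : dot (W 0) p = - (expR (rho p) + 1).
Proof. by have := dot_inverse_offset_base U0; rewrite [theta 0]stereo0 height0. Qed.

Lemma dot_inverse_offset_frame j : dot (W 0) (row j e) = partial j f 0.
Proof. by have := dot_inverse_offset_dstereo j U0; rewrite dstereo0. Qed.

(** Differentiate <W, theta_k> = f_k; the second derivative of theta at p is
normal and is paired with <W, p> = - (e^rho + 1). *)
Lemma partial_inverse_offset_frame i k :
  dot (partial i W 0) (row k e) =
  partial i (partial k f) 0 - (expR (rho p) + 1) * (i == k)%:R.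
Proof.
have dW := is_derive_dot (Dk_is_derive i Dk_inverse_offset U0)
  (is_derive_dstereo0 p e k i).
have E y : U y -> dot (W y) (dstereo p e k y) = partial k f y.
  exact: dot_inverse_offset_dstereo.
have df := Dk_is_derive i (Dk_partial k fD) U0.
rewrite -(is_derive_open_unique oU U0 E dW df) dotZr dot_inverse_offset_p.
by rewrite dstereo0 (eq_sym k i); case: (i == k) => /=; ring.
Qed.

Lemma unreflected0 i : V i 0 = \sum_(k < 2) tangent_coef i k *: row k e.
Proof.
have := dot_unreflected_base i U0; rewrite [theta 0]stereo0 => Vp.
rewrite [LHS](frame_expansion pS pe) Vp scale0r add0r.
apply: eq_bigr => k _; congr (_ *: _).
have := dot_inverse_offset_frame k; have := partial_inverse_offset_frame i k.
rewrite /V /tangent_coef dstereo0; move: (W 0) (partial i W 0) => w dw Ew' Ew.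
rewrite !dotE Ew' Ew !rowE (dot_frame pe) dot_delta mxE eqxx/= (eq_sym k i).
move: (partial i (partial k f) 0) (partial i f 0) (partial k f 0) => fik fi fk.
by case: (i == k) => /=; ring.
Qed.

Local Notation a := (expR (rho p)).
Local Notation M := (dot (W 0) (W 0)).

Definition tangent_coef_mx : 'M[R]_2 := \matrix_(i, k) tangent_coef i k.
Local Notation B := tangent_coef_mx.

Lemma unreflected0_mx i : V i 0 = row i B *m e.
Proof.
rewrite unreflected0 mulmx_sum_row; apply: eq_bigr => k _.
by rewrite !mxE.
Qed.

Lemma dot_envelope_partial i j :
  dot (partial i X 0) (partial j X 0) = 4 / M ^+ 2 * (B *m B^T) i j.
Proof.
have M0 := inverse_offset_neq0 U0.
rewrite !envelope_partial// dotZl dotZr reflection_isometry//.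
rewrite !unreflected0_mx (dot_frame pe).
have -> : dot (row i B) (row j B) = (B *m B^T) i j.
  by rewrite /dot mxE; apply: eq_bigr => k _; rewrite !mxE.
by move: ((B *m B^T) i j) M M0 => S m m0; field.
Qed.

(** In other words (1 - |X|^2) / |X - theta|^2 = e^f, the equation of the
horosphere, as |X - theta|^2 = 4 / |W|^2. *)
Lemma envelope_norm z : U z ->
  1 - dot (X z) (X z) = 4 * expR (f z) / dot (W z) (W z).
Proof.
move=> Uz; have M0 := inverse_offset_neq0 Uz; have wt := dot_inverse_offset_base Uz.
have tt : dot (theta z) (theta z) = 1 := stereo_sphere pS pe z.
rewrite envelopeE//; move: (theta z) (W z) (expR _) M0 wt tt => t w b M0 wt tt.
by rewrite !dotE (dotC t w) wt tt; field.
Qed.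

Lemma radius_norm z : U z -> dot (radius z) (radius z) = (expR (f z) + 1)^-1 ^+ 2.
Proof.
move=> Uz; rewrite radiusE// dotZl dotZr reflection_isometry ?inverse_offset_neq0//.
by rewrite (stereo_sphere pS pe z : dot _ _ = 1) mulr1; ring.
Qed.

Definition dcenter j : 'rV[R]_3 :=
  (a * partial j f 0 / (a + 1) ^+ 2) *: p + (a / (a + 1)) *: row j e.

Lemma is_derive_center j : is_derive 0 (delta_mx 0 j)
  (fun z => horosphere_center (theta z) (f z)) (dcenter j).
Proof.
have a1 := expR1_neq0 (rho p).
have da := is_derive_expR_comp (Dk_is_derive j fD U0).
have da1 : is_derive (0 : 'rV[R]_2) (delta_mx 0 j) (fun z => expR (f z) + 1)
    (expR (f 0) * partial j f 0).
  apply: is_derive_eq (is_deriveD da (is_derive_cst (1 : R) _ _)) _.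
  exact: addr0.
rewrite (_ : (fun z => _) =
  fun z => (expR (f z) * (expR (f z) + 1)^-1) *: theta z); last first.
  by apply/funext => z; rewrite horosphere_centerE.
have dth := is_derive_stereo p e j 0.
have di := @is_derive_inv _ _ (fun z => expR (f z) + 1) _ _ _ (expR1_neq0 _) da1.
have dq := is_derive_mul da di.
apply: is_derive_eq (is_derive_scale dq dth) _.
rewrite dstereo0 stereo0 height0 /dcenter; congr (_ *: _ + _).
by move: (partial j f 0) => fj; field.
Qed.

(** The centres move orthogonally to W, hence their velocities are fixed by the
reflection in W. *)
Lemma dot_inverse_offset_dcenter j : dot (W 0) (dcenter j) = 0.
Proof.
have a1 := expR1_neq0 (rho p).
rewrite /dcenter dotDr !dotZr dot_inverse_offset_p dot_inverse_offset_frame.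
by move: (partial j f 0) => fj; field.
Qed.

Lemma dot_envelope_partial_dcenter i j :
  dot (partial i X 0) (dcenter j) = 2 / M * (a / (a + 1)) * B i j.
Proof.
rewrite envelope_partial// dotZl dot_reflectionl /reflection.
rewrite dot_inverse_offset_dcenter mulr0 mul0r scale0r subr0 -mulrA; congr (_ * _).
rewrite unreflected0_mx /dcenter dotDr !dotZr (dot_frame_base pe) mulr0 add0r.
by rewrite (rowE j e) (dot_frame pe) dot_delta mxE.
Qed.

(** Differentiate <X_i, n> = 0 in direction j, with n_j = c_j - X_j. *)
Lemma dot_second_partial i j :
  dot (partial j (partial i X) 0) (radius 0) =
  dot (partial i X 0) (partial j X 0) - dot (partial i X 0) (dcenter j).
Proof.
have dn : is_derive 0 (delta_mx 0 j) radius (dcenter j - partial j X 0).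
  exact: is_deriveB (is_derive_center j) (Dk_is_derive j Dk_envelope U0).
have dXn := is_derive_dot (Dk_is_derive j (Dk_partial i Dk_envelope) U0) dn.
have E y : U y -> dot (partial i X y) (radius y) = cst 0 y.
  exact: radius_normal.
have := is_derive_open_unique oU U0 E dXn (is_derive_cst (0 : R) _ _).
rewrite dotDr dotNr => /eqP; rewrite addr_eq0 => /eqP ->.
by rewrite opprB.
Qed.

(** The contribution of X_j to n_j and the Christoffel term add up to exactly the
first fundamental form; what is left comes from the motion of the centre. *)
Lemma second_form_envelope N :
  is_horosphere_normal p (rho p) (envelope rho Drho p) N ->
  second_form X 0 N = first_form X 0
   - (4 / (1 - dot (X 0) (X 0)) ^+ 2 * (4 * a ^+ 2 / M ^+ 2)) *: B.
Proof.
have a1 := expR1_neq0 (rho p); have a0 : a != 0 by rewrite gt_eqF// expR_gt0.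
have M0 := inverse_offset_neq0 U0.
have X0 : X 0 = envelope rho Drho p by rewrite /X/= /theta stereo0.
have q := envelope_norm U0; rewrite height0 in q.
have q0 : 0 < 1 - dot (X 0) (X 0).
  by rewrite q divr_gt0 ?inverse_offset_gt0// mulr_gt0// expR_gt0.
have rad0 : radius 0 = horosphere_center p (rho p) - X 0.
  by rewrite /radius height0 /theta stereo0.
have x1 : dot (X 0) (X 0) < 1 by rewrite -subr_gt0.
have rr : dot (horosphere_center p (rho p) - X 0)
    (horosphere_center p (rho p) - X 0) = (a + 1)^-1 ^+ 2.
  by rewrite -rad0 radius_norm// height0.
rewrite -X0 => /(horosphere_normalE x1 rr); rewrite -rad0.
set k := _ / 2 => Nk.
apply/matrixP => i j; rewrite mxE [in RHS]mxE.
have XN l : dot (partial l X 0) N = 0 by rewrite Nk dotZr radius_normal// mulr0.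
rewrite hyp_cov_deriv//; last by rewrite lt_eqF.
rewrite Nk !dotZr dot_second_partial dot_envelope_partial_dcenter.
have -> : dot (X 0) (radius 0) = 2 * a / M - (a + 1)^-1.
  rewrite rad0 horosphere_centerE envelopeE//.
  rewrite [theta 0]stereo0; have wp := dot_inverse_offset_p.
  have pp : dot p p = 1 := pS.
  move: (W 0) (expR _) a1 M0 wp => w b b1 M0 wp.
  by rewrite !dotE (dotC p w) wp pp; field; rewrite b1.
rewrite !mxE /hyp /k q.
move: (dot (partial i X 0) _) (tangent_coef i j) M a a0 a1 M0.
move=> g h m b b0 b1 m0.
by field; rewrite ?b0 ?b1 ?m0.
Qed.

Lemma tangent_coef_mx_sym : B^T = B.
Proof.
apply/matrixP => i k; rewrite !mxE /tangent_coef.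
rewrite (schwarz k i oU U0 (Ck_pred height_Ck)) (eq_sym k i).
move: (partial i (partial k f) 0) (partial i f 0) (partial k f 0) => fik fi fk.
by rewrite (mulrC fk).
Qed.

(** The matrix with rows X_1 and X_2 factors through B, so its rank 2 forces that
of B. *)
Lemma tangent_coef_mx_unit : immersion_at X 0 -> B \in unitmx.
Proof.
rewrite /immersion_at -row_free_unit /row_free => /eqP rkX.
have E : (\matrix_(i < 2) partial i X 0) = (2 / M) *:
    (B *m (e *m (1%:M - (2 / M) *: ((W 0)^T *m W 0)))).
  apply/row_matrixP => i; rewrite rowK envelope_partial// unreflected0_mx.
  by rewrite reflection_mx !rowE -scalemxAr !mulmxA.
rewrite eqn_leq rank_leq_row -[leqLHS]rkX E.
by rewrite (leq_trans (mxrankS (scalemx_sub _ (submx_refl _))))// mxrankM_maxl.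
Qed.

Lemma shape_mx_envelope N : immersion_at X 0 ->
  is_horosphere_normal p (rho p) (envelope rho Drho p) N ->
  shape_mx X 0 N = 1%:M - a ^+ 2 *: invmx B.
Proof.
move=> /tangent_coef_mx_unit Bu /second_form_envelope SF.
rewrite /shape_mx SF; set k := 4 / _.
have M0 := inverse_offset_neq0 U0.
have k0 : k * (4 / M ^+ 2) != 0.
  have q := envelope_norm U0; rewrite height0 in q.
  rewrite /k q !mulf_neq0 ?invr_eq0 ?expf_neq0 ?mulf_neq0 ?invr_eq0//.
  by rewrite gt_eqF// expR_gt0.
have FF : first_form X 0 = (k * (4 / M ^+ 2)) *: (B *m B).
  rewrite -{2}tangent_coef_mx_sym; apply/matrixP => i j.
  rewrite mxE [in RHS]mxE /hyp dot_envelope_partial /k.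
  by move: (_ i j) => S; ring.
have Fu : first_form X 0 \in unitmx.
  by rewrite FF unitmxZ ?unitfE// unitmx_mul Bu.
rewrite mulmxBr mulVmx//; congr (_ - _).
apply: (canLR (mulKmx Fu)); rewrite FF -scalemxAl -scalemxAr scalerA.
rewrite -mulmxA mulmxV// mulmx1; congr (_ *: _).
by ring.
Qed.

(** The chart is isometric at p, so |Drho|^2 is the sum of the squares of the
partial derivatives. *)
Lemma dot_inverse_offset0 :
  M = partial 0 f 0 ^+ 2 + partial 1 f 0 ^+ 2 + (a + 1) ^+ 2.
Proof.
rewrite dot_inverse_offsetE// height0 gradient_chart// sum2 !dstereo0.
rewrite conformal0.
move: (partial 0 f 0) (partial 1 f 0) => fx fy.
rewrite !rowE !scalemxAl -mulmxDl (dot_frame pe) !dotE !dot_delta !mxE.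
by rewrite invr1 /=; ring.
Qed.

End Envelope.

(** * Algebra of two by two matrices *)

Section TwoByTwo.
Context {R : realType}.
Implicit Types A B : 'M[R]_2.

Lemma mx2P A B : A 0 0 = B 0 0 -> A 0 1 = B 0 1 -> A 1 0 = B 1 0 ->
  A 1 1 = B 1 1 -> A = B.
Proof.
move=> A00 A01 A10 A11; apply/matrixP.
have ord2 (i : 'I_2) : i = 0 \/ i = 1.
  by case: i => [[|[|i]] hi]//; [left|right]; exact/val_inj.
by move=> i j; case: (ord2 i) => ->; case: (ord2 j) => ->.
Qed.

Lemma mx2E (x y z t : R) : ((mx2 x y z t 0 0 = x) * (mx2 x y z t 0 1 = y)) *
  ((mx2 x y z t 1 0 = z) * (mx2 x y z t 1 1 = t)).
Proof. by rewrite !mxE. Qed.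

(** The entries of B^-1 are cofactors over det B = a^2 D. That D <> 0 follows from
invertibility of B: otherwise the cofactors, hence the entries of B, would
vanish. *)
Lemma shape_algebra (E F G a : R) (B := mx2 (E + a ^+ 2 / 2) F F (G + a ^+ 2 / 2))
    (D := (E * G - F ^+ 2) * (a ^+ 2)^-1 + a ^+ 2 / 4 + (E + G) / 2) :
  a != 0 -> B \in unitmx ->
  1%:M - a ^+ 2 *: invmx B = D^-1 *: (mx2 ((E - G) / 2) F F ((G - E) / 2)
    + ((E * G - F ^+ 2) * (a ^+ 2)^-1 - a ^+ 2 / 4)%:M).
Proof.
move=> a0 Bu.
pose A := mx2 (G + a ^+ 2 / 2) (- F) (- F) (E + a ^+ 2 / 2).
have BA : B *m A = (a ^+ 2 * D)%:M.
  by apply: mx2P; rewrite mxE sum2 !mx2E mxE/= /D; field.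
have AE : a ^+ 2 * D *: invmx B = A.
  by rewrite -(mulKmx Bu A) BA -mul_mx_scalar.
have D0 : D != 0.
  apply/eqP => D0; move: AE; rewrite D0 mulr0 scale0r => A0.
  have AE i j : A i j = 0 by rewrite -A0 mxE.
  have := AE 0 0; have := AE 0 1; rewrite !mx2E => /eqP.
  rewrite oppr_eq0 => /eqP F0 G0.
  have : (B *m invmx B) 1 1 = 0 by rewrite mxE sum2 /B !mx2E F0 G0 !mul0r addr0.
  by rewrite (mulmxV Bu) mxE => /eqP; rewrite oner_eq0.
have -> : invmx B = (a ^+ 2 * D)^-1 *: A.
  by rewrite -AE scalerA mulVf ?scale1r// mulf_neq0// expf_neq0.
have DE : (E * G - F ^+ 2) * (a ^+ 2)^-1 = D - a ^+ 2 / 4 - (E + G) / 2.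
  by rewrite /D; ring.
rewrite DE; move: (D) D0 => d d0.
by apply: mx2P; rewrite !(mxE, mx2E)/=; field; rewrite ?a0 ?d0.
Qed.
End TwoByTwo.

(** * The second fundamental form of the envelope *)

Theorem proposition5p2 (R : realType) (Omega : set 'rV[R]_3)
    (rho : 'rV[R]_3 -> R) (Drho : 'rV[R]_3 -> 'rV[R]_3)
    (p : 'rV[R]_3) (e : 'M[R]_(2, 3)) (N : 'rV[R]_3) :
  sphere_domain Omega ->
  Ck_on_sphere 3 Omega rho ->
  (forall theta, Omega theta -> is_sphere_gradient rho theta (Drho theta)) ->
  Omega p ->
  tangent_frame p e ->
  immersion_at (envelope rho Drho \o stereo p e) 0 ->
  is_horosphere_normal p (rho p) (envelope rho Drho p) N ->
  let f : 'rV[R]_2 -> R := rho \o stereo p e in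
  let s := rho p in
  let fx : R := partial 0 f 0 in
  let fy : R := partial 1 f 0 in
  let fxx : R := partial 0 (partial 0 f) 0 in
  let fxy : R := partial 1 (partial 0 f) 0 in
  let fyy : R := partial 1 (partial 1 f) 0 in
  let E := fxx + 2^-1 * (fy ^+ 2 - fx ^+ 2 - 1) in
  let F := fxy - fx * fy in
  let G := fyy + 2^-1 * (fx ^+ 2 - fy ^+ 2 - 1) in
  let D := (E * G - F ^+ 2) * expR (- (2 * s)) + expR (2 * s) / 4
           + (E + G) / 2 in
  shape_mx (envelope rho Drho \o stereo p e) 0 N =
  D^-1 *: (mx2 ((E - G) / 2) F F ((G - E) / 2)
           + ((E * G - F ^+ 2) * expR (- (2 * s)) - expR (2 * s) / 4)%:M).
Proof.
move=> OmegaD rhoC rhoG Omegap pe XI XN f s fx fy fxx fxy fyy E F G D.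
have Bu := tangent_coef_mx_unit OmegaD rhoC rhoG Omegap pe XI.
have M0 := dot_inverse_offset0 OmegaD rhoG Omegap pe.
have Bsym := tangent_coef_mx_sym Drho OmegaD rhoC Omegap pe.
rewrite (shape_mx_envelope OmegaD rhoC rhoG Omegap pe XI XN).
(* Both diagonal entries of B: the identity applies with (v, w) = (fx, fy) and
   with (v, w) = (fy, fx). *)
have diag (x u v w : R) : u - v * v
    + ((v ^+ 2 + w ^+ 2 + (x + 1) ^+ 2) / 2 - (x + 1)) * 1 =
    u + 2^-1 * (w ^+ 2 - v ^+ 2 - 1) + x ^+ 2 / 2 by field.
have BE : tangent_coef_mx rho Drho p e =
    mx2 (E + expR s ^+ 2 / 2) F F (G + expR s ^+ 2 / 2).
  have B10 : tangent_coef_mx rho Drho p e 1 0 = F.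
    by rewrite mxE /tangent_coef [X in _ + X]mulr0 addr0 /F (mulrC fx).
  apply: mx2P; rewrite mx2E.
  - by rewrite mxE /tangent_coef M0; exact: diag.
  - by rewrite -B10 -[in RHS]Bsym [RHS]mxE.
  - exact: B10.
  - by rewrite mxE /tangent_coef M0 [X in (X + _) / 2]addrC; exact: diag.
have a2 : expR (2 * s) = expR s ^+ 2 by rewrite expRM_natl.
rewrite BE in Bu *; rewrite /D a2 expRN a2.
by apply: shape_algebra => //; rewrite gt_eqF// expR_gt0.
Qed.
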